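(* Let $j$ be a stationary quantum stochastic process over the involutive algebra $K$ with associated group of automorphisms $\alpha=(\alpha_t)_{t\in\mathbb{R}}$. For any multiplicative $\alpha$-cocycle $W=(W_t)_{t\in\mathbb{R}}$ that is markovian with respect to $j$, the formulas $$\tilde j(x)(t)=j(x)(t),\ t\ge0,\qquad \tilde j(x)(t)=W_t\,j(x)(t)\,W_t^*,\ t\le0,\qquad x\in K_1,$$ $$\tilde\alpha_t(\cdot)=W_t\alpha_t(\cdot)W_t^*,\qquad t\in\mathbb{R},$$ define a new stationary quantum stochastic process $\tilde j$ over $K$ with associated group of automorphisms $\tilde\alpha=(\tilde\alpha_t)_{t\in\mathbb{R}}$ (the values of $\tilde j$ on all of $\tilde K$ being determined by those on $K_1=K$ through $\tilde j(x\odot y)=\tilde j(x)\cup\tilde j(y)$, the product $\cup$ being formed with $\tilde\alpha$).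
   Context: Graded algebra. $K$ is an involutive algebra, $K_i=K^{\otimes i}$, $K_1=K$, and the family $(K_i)_{i\ge1}$ is supplied with a linear associative operation $\odot:K_i\times K_j\to K_{i+j}$ with $K_i\odot K_j=K_{i+j}$; $\tilde K=\oplus_{i\ge1}K_i$ is the resulting graded algebra. Cohomology ring. $\alpha=(\alpha_t)_{t\in\mathbb{R}}$ is a $w^*$-continuous one-parameter group of $*$-automorphisms of $\mathcal{B}(\mathcal{H})$, $\mathcal{H}$ a Hilbert space, whose action is correctly defined also on a certain involutive algebra $\mathcal{M}$ of (in general unbounded) linear operators in $\mathcal{H}$. Consider the standard complex of inhomogeneous cochains $x=x(t_1,\dots,t_i)$ of the group $\mathbb{R}$ with values in $\mathcal{M}$ (with action $\alpha$) and differentials $d_i$. Put $A_i=\ker d_i/\mathrm{Im}\,d_{i-1}$ and $A=\oplus_{i\ge1}A_i$, a ring with multiplication $$(x\cup y)(t_1,\dots,t_{i+k})=x(t_1,\dots,t_i)\,\alpha_{t_1+\dots+t_i}\bigl(y(t_{i+1},\dots,t_{i+k})\bigr),\quad x\in A_i,\ y\in A_k.$$ Elements of $\ker d_i$ are called (additive) $i$-$\alpha$-cocycles; a $1$-$\alpha$-cocycle satisfies $x(t+s)=x(t)+\alpha_t(x(s))$. Stationary quantum stochastic process. A $*$-homomorphism $j$ of the graded algebra $\tilde K$ into the graded algebra $A$ such that every $x\in K_i$ is sent to an $i$-$\alpha$-cocycle $j(x)$ is called a stationary quantum stochastic process over $K$, with associated group $\alpha$. In particular, $j$ transfers $\odot$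 to $\cup$. It is supposed that the operators involved in the image of $j$ generate the whole of $\mathcal{M}$. Markovian cocycles. A multiplicative $\alpha$-cocycle is a strongly continuous family $W=(W_t)_{t\in\mathbb{R}}$ of unitary operators in $\mathcal{H}$ with $W_{t+s}=W_t\alpha_t(W_s)$, $s,t\in\mathbb{R}$; it is supposed that $W_txW_t^*$ is well defined for all $x\in\mathcal{M}$, $t\in\mathbb{R}$. Let $\mathcal{M}_{t]}$ and $\mathcal{M}_{[s}$ be the involutive subalgebras of $\mathcal{M}$ generated by all increments $j(x)(r)-j(x)(l)$, $x\in K_1$, with $l\le r\le t$, respectively $s\le l\le r$. The cocycle $W$ is markovian (with respect to $j$) if $W_t\mathcal{M}_{t]}W_t^*\subset\mathcal{M}_{t]}$ and $W_txW_t^*=x$ for all $x\in\mathcal{M}_{[t}$, $t\ge0$. *)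

(* Defs.v *)
From HB Require Import structures.
From mathcomp Require Import all_boot all_order all_algebra.
From mathcomp Require Import complex.
From mathcomp Require Import all_classical all_reals all_analysis.

Set Implicit Arguments.
Unset Strict Implicit.
Unset Printing Implicit Defensive.

Import Order.TTheory GRing.Theory Num.Theory.
Import numFieldNormedType.Exports.

Local Open Scope classical_set_scope.
Local Open Scope ring_scope.
Local Open Scope complex_scope.

(* No unit is assumed, hence no use of [algType]. *)
Record involutiveAlg (R : realType) := InvolutiveAlg {
  ia_carrier :> lmodType R[i];
  ia_mul : ia_carrier -> ia_carrier -> ia_carrier;
  ia_star : ia_carrier -> ia_carrier;
  ia_mulA : associative ia_mul;
  ia_mul_linearl : forall y, linear (ia_mul^~ y);
  ia_mul_linearr : forall x, linear (ia_mul x);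
  ia_starK : involutive ia_star;
  ia_star_linear : forall (a : R[i]) x y,
    ia_star (a *: x + y) = a^*%C *: ia_star x + ia_star y;
  ia_starM : forall x y, ia_star (ia_mul x y) = ia_mul (ia_star y) (ia_star x)
}.

Definition multilinear (C : pzRingType) (n : nat) (U V : lmodType C)
    (f : ('I_n -> U) -> V) : Prop :=
  forall (l : 'I_n) (x : 'I_n -> U) (a : C) (u v : U),
    f [eta x with l |-> a *: u + v] =
    a *: f [eta x with l |-> u] + f [eta x with l |-> v].

(* [gr i] is the i-th tensor power of K for i >= 1, characterised by the
   universal property of the multilinear map [gr_tens]; [gr 0] is junk and is
   not constrained.  [odot] is an arbitrary bilinear associative operation, not
   necessarily the one induced by the tensor product.  [gr_star] is the
   involution of the graded algebra extending the one of K; like every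
   involution of an algebra it is conjugate-linear and reverses products. *)
Record gradedAlg (R : realType) (K : involutiveAlg R) := GradedAlg {
  gr :> nat -> lmodType R[i];
  gr_tens : forall i, ('I_i -> K) -> gr i;
  gr_tens_multilinear : forall i, (0 < i)%N -> multilinear (@gr_tens i);
  gr_tens_universal : forall i, (0 < i)%N ->
    forall (V : lmodType R[i]) (f : ('I_i -> K) -> V), multilinear f ->
    exists! g : gr i -> V, linear g /\ forall x, g (gr_tens x) = f x;
  odot : forall i k, gr i -> gr k -> gr (i + k);
  odot_linearl : forall i k, (0 < i)%N -> (0 < k)%N ->
    forall y : gr k, linear (fun x : gr i => odot x y);
  odot_linearr : forall i k, (0 < i)%N -> (0 < k)%N ->
    forall x : gr i, linear (fun y : gr k => odot x y);
  odotA : forall i k l, (0 < i)%N -> (0 < k)%N -> (0 < l)%N ->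
    forall (x : gr i) (y : gr k) (z : gr l),
    ecast n (gr n) (addnA i k l) (odot x (odot y z)) = odot (odot x y) z;
  odot_span : forall i k, (0 < i)%N -> (0 < k)%N -> forall z : gr (i + k),
    exists (n : nat) (x : 'I_n -> gr i) (y : 'I_n -> gr k),
      z = \sum_(l < n) odot (x l) (y l);
  gr_star : forall i, gr i -> gr i;
  gr_starK : forall i, (0 < i)%N -> involutive (@gr_star i);
  gr_star_linear : forall i, (0 < i)%N -> forall (a : R[i]) (x y : gr i),
    gr_star (a *: x + y) = a^*%C *: gr_star x + gr_star y;
  gr_star_odot : forall i k, (0 < i)%N -> (0 < k)%N ->
    forall (x : gr i) (y : gr k),
    gr_star (odot x y) =
    ecast n (gr n) (addnC k i) (odot (gr_star y) (gr_star x));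
  gr_star1 : forall x : K,
    gr_star (gr_tens (fun _ : 'I_1 => x)) =
    gr_tens (fun _ : 'I_1 => ia_star x)
}.

(* The identification of K with [gr 1]. *)
Definition gr1 (R : realType) (K : involutiveAlg R) (G : gradedAlg K) (x : K) :
  G 1%N := @gr_tens R K G 1%N (fun=> x).

Definition adjoint_pair (C V : Type) (dot : V -> V -> C) (a b : V -> V) : Prop :=
  forall u v, dot (a u) v = dot u (b v).

(* The adjoint of [a], when it exists; it is unique if [dot] is definite. *)
Definition adj (C : Type) (V : nmodType) (dot : V -> V -> C) (a : V -> V) :
  V -> V := xget (fun=> 0) [set b | adjoint_pair dot a b].

Section operators.
Context (R : realType) (H : completeNormedModType R[i]).
(* [ip] is linear in its first argument. *)
Variable ip : {dot H for Num.conj}.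

Definition bounded_op : set (H -> H) :=
  [set a | linear a /\ continuous a].

Definition unitary (U : H -> H) : Prop :=
  [/\ linear U, forall u v, ip (U u) (U v) = ip u v & set_surj setT setT U].

Definition bconj (U a : H -> H) : H -> H := U \o a \o adj ip U.

(* [theta] is only constrained on the bounded operators. *)
Definition star_automorphism (theta : (H -> H) -> (H -> H)) : Prop :=
  [/\ set_bij bounded_op bounded_op theta,
      forall (c : R[i]) a b, bounded_op a -> bounded_op b ->
        theta (c *: a + b) = c *: theta a + theta b,
      forall a b, bounded_op a -> bounded_op b ->
        theta (a \o b) = theta a \o theta b &
      forall a, bounded_op a -> theta (adj ip a) = adj ip (theta a)].

(* The w*-continuous functionals on the bounded operators are exactly
   a |-> \sum_n <a xi_n, eta_n> with xi, eta square summable. *)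
Definition wstar_continuous (f : R -> (H -> H)) : Prop :=
  forall xi eta : nat -> H,
    cvgn (series (fun n => `|xi n| ^+ 2)) ->
    cvgn (series (fun n => `|eta n| ^+ 2)) ->
    continuous (fun t => limn (series (fun n => ip (f t (xi n)) (eta n)))).

Definition automorphism_group (alpha : R -> (H -> H) -> (H -> H)) : Prop :=
  [/\ forall t, star_automorphism (alpha t),
      forall a, bounded_op a -> alpha 0 a = a,
      forall t s a, bounded_op a -> alpha (t + s) a = alpha t (alpha s a) &
      forall a, bounded_op a -> wstar_continuous (alpha^~ a)].

(* The unitary [U] implements [theta].  Every *-automorphism of the algebra of
   bounded operators is of this form, and [U] is unique up to a phase. *)
Definition implements (theta : (H -> H) -> (H -> H)) (U : H -> H) : Prop :=
  unitary U /\ forall a, bounded_op a -> theta a = bconj U a.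

Definition implementer (theta : (H -> H) -> (H -> H)) : H -> H :=
  xget (idfun : H -> H) [set U | implements theta U].

Section domain.
Context (P : {pred H}) (D : subLmodType P).

Definition dotD (u v : D) : R[i] := ip (val u) (val v).

(* [U] maps the domain onto itself. *)
Definition stable (U : H -> H) : Prop :=
  forall v : D, U (val v) \in P /\ adj ip U (val v) \in P.

(* Restriction to the domain; meaningful only if [U (val v)] is in the domain. *)
Definition restr (U : H -> H) : D -> D := fun v => insubd v (U (val v)).

(* U x U^* for a unitary [U] that is [stable]. *)
Definition uconj (U : H -> H) (x : D -> D) : D -> D :=
  restr U \o x \o restr (adj ip U).

(* The action of an automorphism of the bounded operators on operators with
   domain D; it does not depend on the choice of the implementing unitary. *)
Definition act (theta : (H -> H) -> (H -> H)) : (D -> D) -> (D -> D) :=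
  uconj (implementer theta).

(* Involutive algebras of linear operators in H with domain D (O*-algebras):
   every element has an adjoint that is defined on D and leaves D invariant. *)
Definition star_opalg (N : set (D -> D)) : Prop :=
  [/\ forall x, N x -> [/\ linear x, N (adj dotD x) &
                           adjoint_pair dotD x (adj dotD x)],
      N (0 : D -> D),
      forall (c : R[i]) x y, N x -> N y -> N (c *: x + y) &
      forall x y, N x -> N y -> N (x \o y)].

Definition generated (S : set (D -> D)) : set (D -> D) := smallest star_opalg S.

Definition acts_on (alpha : R -> (H -> H) -> (H -> H)) (M : set (D -> D)) :
    Prop :=
  forall t, (exists2 U, implements (alpha t) U & stable U) /\
            forall x, M x -> M (act (alpha t) x).

Definition cochain (n : nat) : Type := 'rV[R]_n -> (D -> D).

Section complex.
Variable alpha : R -> (H -> H) -> (H -> H).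

(* (t_0, ..., t_n) |-> (t_0, ..., t_k + t_(k+1), ..., t_n) *)
Definition merge (n : nat) (k : 'I_n) (t : 'rV[R]_n.+1) : 'rV[R]_n :=
  \row_(l < n) (if (l < k)%N then t 0 (lift ord_max l)
                else if l == k then t 0 (lift ord_max l) + t 0 (lift ord0 l)
                else t 0 (lift ord0 l)).

Definition differential (n : nat) (x : cochain n) : cochain n.+1 := fun t =>
  act (alpha (t 0 ord0)) (x (col' ord0 t))
  + \sum_(k < n) (-1) ^+ k.+1 *: x (merge k t)
  + (-1) ^+ n.+1 *: x (col' ord_max t).

Definition cocycle (M : set (D -> D)) (n : nat) (x : cochain n) : Prop :=
  (forall t, M (x t)) /\ differential x = (fun=> 0).

Definition total (n : nat) (t : 'rV[R]_n) : R := \sum_(l < n) t 0 l.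

Definition cup (n k : nat) (x : cochain n) (y : cochain k) : cochain (n + k) :=
  fun t => x (lsubmx t) \o act (alpha (total (lsubmx t))) (y (rsubmx t)).

(* The involution of the ring of cochains:
     x^*(t_1, ..., t_n) =
       (-1)^n alpha_(t_1 + ... + t_n)(x(-t_n, ..., -t_1))^*.
   It satisfies (x \cup y)^* = y^* \cup x^*, and since a 1-cocycle satisfies
   alpha_t(x(-t)) = - x(t), it is x^*(t) = x(t)^* on 1-cocycles.  The pointwise
   adjoint in degree n > 1 does not reverse cup products. *)
Definition cochain_star (n : nat) (x : cochain n) : cochain n := fun t =>
  (-1) ^+ n *: adj dotD
    (act (alpha (total t)) (x (\row_(l < n) - t 0 (rev_ord l)))).

End complex.

Section process.
Context (K : involutiveAlg R) (G : gradedAlg K).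

(* The class of the cocycle [j i x] modulo coboundaries is the image of x in
   the cohomology ring; as the values of the process matter, products are
   transferred at the level of the cocycles themselves. *)
Record stationary_process (alpha : R -> (H -> H) -> (H -> H))
    (M : set (D -> D)) (j : forall i, G i -> cochain i) : Prop :=
  StationaryProcess {
  sp_group : automorphism_group alpha;
  sp_algebra : star_opalg M;
  sp_acts : acts_on alpha M;
  sp_linear : forall i, (0 < i)%N -> forall (c : R[i]) (x y : G i) t,
    j i (c *: x + y) t = c *: j i x t + j i y t;
  sp_cocycle : forall i, (0 < i)%N -> forall x : G i, cocycle alpha M (j i x);
  sp_cup : forall i k, (0 < i)%N -> (0 < k)%N -> forall (x : G i) (y : G k),
    j (i + k)%N (odot x y) = cup alpha (j i x) (j k y);
  sp_star : forall i, (0 < i)%N -> forall x : G i,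
    j i (gr_star x) = cochain_star alpha (j i x);
  sp_generated :
    M = generated [set a | exists i (x : G i) t, (0 < i)%N /\ a = j i x t]
}.

Variable j : forall i, G i -> cochain i.

Definition value1 (x : K) (t : R) : D -> D :=
  j (gr1 G x) (const_mx t : 'rV[R]_1).

Definition past (t : R) : set (D -> D) :=
  generated [set a | exists (x : K) (l r : R),
    [/\ l <= r, r <= t & a = value1 x r - value1 x l]].

Definition future (s : R) : set (D -> D) :=
  generated [set a | exists (x : K) (l r : R),
    [/\ s <= l, l <= r & a = value1 x r - value1 x l]].

(* [stable (W t)] expresses that W_t x W_t^* is well defined for every x in an
   algebra of operators with domain D. *)
Record multiplicative_cocycle (alpha : R -> (H -> H) -> (H -> H))
    (W : R -> (H -> H)) : Prop := MultiplicativeCocycle {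
  mc_unitary : forall t, unitary (W t);
  mc_continuous : forall u : H, continuous (fun t => W t u);
  mc_cocycle : forall t s, W (t + s) = W t \o alpha t (W s);
  mc_stable : forall t, stable (W t)
}.

Definition markovian (W : R -> (H -> H)) : Prop :=
  forall t, 0 <= t ->
    (forall x, past t x -> past t (uconj (W t) x)) /\
    (forall x, future t x -> uconj (W t) x = x).

End process.
End domain.
End operators.

(* Main.v *)
Require Import Defs.
From HB Require Import structures.
From mathcomp Require Import all_boot all_order all_algebra.
From mathcomp Require Import complex.
From mathcomp Require Import all_classical all_reals all_analysis.
From mathcomp Require Import ring.

Set Implicit Arguments.
Unset Strict Implicit.
Unset Printing Implicit Defensive.

Import Order.TTheory GRing.Theory Num.Theory.
Import numFieldNormedType.Exports.

Local Open Scope classical_set_scope.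
Local Open Scope ring_scope.
Local Open Scope complex_scope.

(** Write [w_t] for the conjugation by [W_t] and [A_t] for the action of
    [alpha_t], both on operators with domain [D].  The action of the perturbed
    group is [A'_t = w_t A_t], and the multiplicative cocycle identity becomes
    the intertwining relation [w_(t+s) A_t = A'_t w_s] ([cocycle_act]).

    The new process is locally conjugate to the old one by a single unitary.
    Markovianity says that [w_s] fixes the increments after time [s >= 0]; by
    stationarity [w_(-s)] then fixes every increment between nonnegative times
    ([cocycle_neg_fix], [value1_fix]).  The value [j(x)(t_1, ..., t_n)] is built
    from increments between the partial sums of [t_1, ..., t_n], because the
    degree is generated by products of elements of degree 1; hence
    [w_(-T) (j(x)(t))] is the same operator for all [T] beyond the sum of the
    [|t_l|] ([shifted_fix], [deformed_processE]).  This common value is taken as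
    the definition of the new process in every degree at once.  It depends on
    the element [x] of [K_n] only, so there is nothing to check about the many
    ways of writing [x] as a sum of products.  On [K_1] it gives [j(x)(t)] for
    [t >= 0] and [W_t j(x)(t) W_t^*] for [t <= 0].

    Each algebraic law of a process (cup product, cocycle identity, involution)
    involves finitely many values, so one [T] serves for all of them; [w_(-T)]
    is a *-homomorphism, and it turns the law for [j] and [A] into the law for
    the new process and [A'] thanks to the shift formula
    [w_(-T) A_s (j(x)(t)) = A'_s (j'(x)(t))] ([deformed_shift]).

    Two points are of a different nature.  The action on unbounded operators is
    defined through a chosen implementing unitary, so it has to be independent
    of this choice, which holds since implementing unitaries are unique up to a
    phase ([implements_phase]).  And the perturbed group has to be w*-continuous:
    its matrix elements are continuous, and the series of matrix elements
    converge uniformly in the time ([perturbed_automorphism_group]). *)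

(** * Adjoints and unitary operators *)

Lemma linear_map0 (C : pzRingType) (U V : lmodType C) (f : U -> V) :
  linear f -> f 0 = 0.
Proof. by move=> lf; have := lf (-1) 0 0; rewrite scaler0 addr0 scaleN1r addNr. Qed.

Lemma linear_map_comp (C : pzRingType) (U V X : lmodType C)
    (f : V -> X) (g : U -> V) :
  linear f -> linear g -> linear (f \o g).
Proof. by move=> lf lg a u v /=; rewrite lg lf. Qed.

Section adjoints.
Context (C : numClosedFieldType) (V : lmodType C) (dot : V -> V -> C).
Hypothesis dotC : forall u v, dot u v = Num.conj (dot v u).
Hypothesis dotP : forall w, linear_for *%R (dot^~ w).
Hypothesis dot_eq0 : forall u, dot u u = 0 -> u = 0.

(** Definiteness makes an adjoint unique, so that [adj] is computed by
    exhibiting any adjoint. *)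
Lemma dot_injr (b c : V) : (forall u, dot u b = dot u c) -> b = c.
Proof.
move=> bc; apply/eqP; rewrite -subr_eq0; apply/eqP/dot_eq0.
rewrite -[X in dot X _]addrC -scaleN1r dotP mulN1r [dot c _]dotC [dot b _]dotC.
by rewrite [dot _ b]bc addNr.
Qed.

Lemma dot_injl (b c : V) : (forall u, dot b u = dot c u) -> b = c.
Proof. by move=> bc; apply: dot_injr => u; rewrite dotC bc -dotC. Qed.

Lemma adjoint_pairC (a b : V -> V) : adjoint_pair dot a b -> adjoint_pair dot b a.
Proof. by move=> ab u v; rewrite dotC -ab -dotC. Qed.

Lemma adjoint_pair_adj (a b : V -> V) : adjoint_pair dot a b -> adj dot a = b.
Proof.
move=> ab; apply: xget_unique => // c ac; apply/funext => v.
by apply: dot_injr => u; rewrite -ac ab.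
Qed.

(** An operator that has an adjoint is linear, since it is determined by its
    matrix elements. *)
Lemma adjoint_pair_linear (a b : V -> V) : adjoint_pair dot a b -> linear a.
Proof.
by move=> ab c u v; apply: dot_injl => w; rewrite ab !dotP -!ab.
Qed.

(** The identity also covers operators without an adjoint: then the conjugate
    has none either, and both sides are the default value 0 of [adj]. *)
Lemma adj_conjugate (U U' x : V -> V) :
  cancel U U' -> cancel U' U -> adjoint_pair dot U U' -> U 0 = 0 ->
  adj dot (U \o x \o U') = U \o adj dot x \o U'.
Proof.
move=> UK UK' UU' U0; have U'U := adjoint_pairC UU'.
have conj_pair (y b : V -> V) : adjoint_pair dot y b ->
    adjoint_pair dot (U \o y \o U') (U \o b \o U').
  by move=> yb u v /=; rewrite UU' yb U'U.
have [[b xb]|nx] := pselect (exists b, adjoint_pair dot x b).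
  by rewrite (adjoint_pair_adj (conj_pair _ _ xb)) (adjoint_pair_adj xb).
rewrite /adj xgetPN; last first.
  move=> b xb; apply: nx; exists (U' \o b \o U) => u v /=.
  by rewrite -UU' -[in RHS]xb /= UU' !UK.
rewrite xgetPN; last by move=> b xb; apply: nx; exists b.
by apply/funext => v /=; rewrite U0.
Qed.

End adjoints.

Section unitaries.
Context (R : realType) (H : completeNormedModType R[i]).
Variable ip : {dot H for Num.conj}.

Lemma ipC u v : ip u v = Num.conj (ip v u).
Proof. by rewrite (hermC ip) expr0 mul1r. Qed.

Lemma ipP w : linear_for *%R (ip^~ w).
Proof. by move=> c u v; rewrite linearPl. Qed.

Lemma ip_eq0 u : ip u u = 0 -> u = 0.
Proof. by move=> /eqP; rewrite dnorm_eq0 => /eqP. Qed.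

(** The adjoint of a unitary is its inverse, which exists because unitaries are
    surjective. *)
Lemma unitary_inverse (U : H -> H) : unitary ip U ->
  [/\ cancel U (adj ip U), cancel (adj ip U) U & adjoint_pair ip U (adj ip U)].
Proof.
case=> Ulin Uiso Usurj.
have /choice [V VK] : forall v, exists u, U u = v.
  by move=> v; have [u _ <-] := Usurj v I; exists u.
have UV : adjoint_pair ip U V by move=> u v; rewrite -{1}(VK v) Uiso.
rewrite (adjoint_pair_adj ipC ipP ip_eq0 UV); split => // u.
by apply: (dot_injr ipC ipP ip_eq0) => v; rewrite -UV Uiso.
Qed.

Lemma unitary_adj (U : H -> H) : unitary ip U -> unitary ip (adj ip U).
Proof.
move=> uU; have [UK VK UV] := unitary_inverse uU; split.
- exact: (adjoint_pair_linear ipC ipP ip_eq0 (adjoint_pairC ipC UV)).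
- by move=> u v; rewrite -UV VK.
- by move=> u _; exists (U u).
Qed.

Lemma adj_unitaryK (U : H -> H) : unitary ip U -> adj ip (adj ip U) = U.
Proof.
move=> uU; have [_ _ UV] := unitary_inverse uU.
exact: (adjoint_pair_adj ipC ipP ip_eq0 (adjoint_pairC ipC UV)).
Qed.

Lemma unitary_comp (U V : H -> H) :
  unitary ip U -> unitary ip V -> unitary ip (U \o V).
Proof.
move=> uU uV; have [UK VK _] := unitary_inverse uU.
have [UK' VK' _] := unitary_inverse uV.
case: uU uV => Ul Ui _ [Vl Vi _]; split; first exact: linear_map_comp.
- by move=> u v /=; rewrite Ui Vi.
- by move=> u _; exists (adj ip V (adj ip U u)) => //=; rewrite VK' VK.
Qed.

Lemma adj_unitary_comp (U V : H -> H) :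
  unitary ip U -> unitary ip V -> adj ip (U \o V) = adj ip V \o adj ip U.
Proof.
move=> uU uV; apply: (adjoint_pair_adj ipC ipP ip_eq0) => u v /=.
by have [_ _ ->] := unitary_inverse uU; have [_ _ ->] := unitary_inverse uV.
Qed.

Lemma unitary_id : unitary ip idfun.
Proof. by split => // u _; exists u. Qed.

Lemma adj_id : adj ip (idfun : H -> H) = idfun.
Proof. exact: (adjoint_pair_adj ipC ipP ip_eq0). Qed.

Lemma unitary_scale (c : R[i]) (U : H -> H) : `|c| = 1 -> unitary ip U ->
  unitary ip (c *: U) /\ adj ip (c *: U) = Num.conj c *: adj ip U.
Proof.
move=> c1 uU; have [UK VK UV] := unitary_inverse uU.
have cc : c * Num.conj c = 1 by rewrite -normCK c1 expr1n.
case: uU => Ul Ui _; split; last first.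
  apply: (adjoint_pair_adj ipC ipP ip_eq0) => u v /=.
  by rewrite scalrfctE linearZl_LR linearZr_LR /= conjCK UV.
split.
- move=> a u v; by rewrite scalrfctE Ul scalerDr !scalerA mulrC.
- move=> u v; by rewrite scalrfctE linearZl_LR linearZr_LR /= mulrA cc mul1r Ui.
- move=> u _; exists (Num.conj c *: adj ip U u) => //.
  rewrite !scalrfctE -[X in U X]addr0 Ul (linear_map0 Ul) addr0 VK.
  by rewrite scalerA cc scale1r.
Qed.

Lemma continuous_linear_bound (f : H -> H) : linear f -> continuous f ->
  exists2 c : R[i], 0 <= c & forall u, `|f u| <= c * `|u|.
Proof.
move=> lf cf.
pose g : {linear H -> H} := HB.pack f (GRing.isLinear.Build _ _ _ _ f lf).
have /linear_boundedP/pinfty_ex_gt0 [c c0 hc] : bounded_near g (nbhs (0 : H)).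
  exact/linear_bounded_continuous.
by exists c; [exact: ltW | exact: hc].
Qed.

Lemma linear_bound_continuous (f : H -> H) (c : R[i]) : linear f ->
  (forall u, `|f u| <= c * `|u|) -> continuous f.
Proof.
move=> lf hc.
pose g : {linear H -> H} := HB.pack f (GRing.isLinear.Build _ _ _ _ f lf).
apply: (bounded_linear_continuous (f := g)); apply/bounded_funP => r.
exists (`|c| * r) => u ur; apply: le_trans (hc u) _.
have [c0|] := boolP (0 <= c * `|u|).
  by rewrite -(ger0_norm c0) normrM normr_id ler_wpM2l.
by have := le_trans (normr_ge0 _) (hc u) => ->.
Qed.

Hypothesis ip_norm : forall u : H, `|u| ^+ 2 = ip u u.

(** Expand [ip (u - a *: v) (u - a *: v) >= 0] at the minimising
    [a = ip u v / ip v v]. *)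
Lemma ip_CauchySchwarz u v : `|ip u v| <= `|u| * `|v|.
Proof.
have [->|v0] := eqVneq v 0; first by rewrite linear0r !normr0 mulr0.
rewrite -(@ler_pXn2r _ 2) ?nnegrE ?mulr_ge0// exprMn !ip_norm.
have vv : 0 < ip v v by rewrite dnorm_gt0.
set a := ip u v / ip v v.
have := dnorm_ge0 ip (u - a *: v); rewrite dnormB dnormZ linearZr_LR /=.
have ra : Num.conj a = Num.conj (ip u v) / ip v v.
  by rewrite rmorphM fmorphV [in X in _ / X]/= -ipC.
have -> : Num.conj a * ip u v = `|ip u v| ^+ 2 / ip v v.
  by rewrite ra mulrAC normCKC.
have -> : `|a| ^+ 2 * ip v v = `|ip u v| ^+ 2 / ip v v.
  rewrite normrM exprMn normrV ?unitfE ?gt_eqF// (gtr0_norm vv).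
  by rewrite -mulrA; congr (_ * _); rewrite expr2 -mulrA mulVf ?gt_eqF // mulr1.
rewrite rmorphM fmorphV /= -ipC rmorphXn /= conj_normC.
by rewrite opprD addrA addrK subr_ge0 ler_pdivrMr.
Qed.

Lemma unitary_norm (U : H -> H) u : unitary ip U -> `|U u| = `|u|.
Proof.
case=> _ Ui _; apply/eqP; rewrite -(@eqrXn2 _ 2) //.
by rewrite !ip_norm Ui.
Qed.

Lemma unitary_bounded (U : H -> H) : unitary ip U -> bounded_op U.
Proof.
move=> uU; have [Ul _ _] := uU; split => //.
by apply: (@linear_bound_continuous _ 1) => // u; rewrite unitary_norm// mul1r.
Qed.

(** Rank one operators are the test operators that detect scalars in
    [implements_phase]. *)
Lemma rank_one_bounded (v w : H) : bounded_op (fun u => ip u w *: v).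
Proof.
have l : linear (fun u => ip u w *: v).
  by move=> a u u'; rewrite ipP scalerDl scalerA.
split => //; apply: (@linear_bound_continuous _ (`|w| * `|v|)) => // u.
rewrite normrZ mulrC mulrAC mulrC ler_wpM2r//.
by rewrite (le_trans (ip_CauchySchwarz _ _)) ?(mulrC `|w|).
Qed.

Lemma bounded_comp (a b : H -> H) :
  bounded_op a -> bounded_op b -> bounded_op (a \o b).
Proof.
move=> [la ca] [lb cb]; split; first exact: linear_map_comp.
by move=> u; apply: continuous_comp; [exact: cb|exact: ca].
Qed.

(** If [U] and [V] implement the same map, then [Z = U^* V] commutes with every
    bounded operator.  Commutation with the rank one operators
    [u |-> ip u w *: v] gives [ip w w *: Z v = ip (Z w) w *: v] for all [v], so
    [Z] is the scalar [ip (Z w) w / ip w w], of modulus 1 since [Z] is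
    unitary. *)
Lemma implements_phase (theta : (H -> H) -> (H -> H)) (U V : H -> H) :
  implements ip theta U -> implements ip theta V ->
  exists2 c : R[i], `|c| = 1 & V = c *: U.
Proof.
move=> [uU hU] [uV hV].
have [UK VK UV] := unitary_inverse uU.
have [UK' VK' UV'] := unitary_inverse uV.
have uZ := unitary_comp (unitary_adj uU) uV.
set Z := adj ip U \o V in uZ.
have Zcomm a : bounded_op a -> Z \o a = a \o Z.
  move=> ba; apply/funext => u; rewrite /Z /=.
  have := hU _ ba; rewrite hV // => /(congr1 (fun f => adj ip U (f (V u)))).
  by rewrite /bconj /= UK' UK.
have VZ : V = U \o Z by apply/funext => u; rewrite /Z /= VK.
have [[w w0]|nw] := pselect (exists w : H, w != 0); last first.
  (* On the zero space every scalar works. *)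
  have z (u : H) : u = 0 by apply/eqP/negPn/negP => u0; apply: nw; exists u.
  exists 1; first by rewrite normr1.
  by apply/funext => u; rewrite (z (V u)) (z ((1 *: U) u)).
have ww : ip w w != 0 by rewrite dnorm_eq0.
pose c := ip (Z w) w / ip w w.
have [Zl Zi _] := uZ.
have ZZ k u : Z (k *: u) = k *: Z u.
  by rewrite -[X in Z X]addr0 Zl (linear_map0 Zl) addr0.
have Zc v : Z v = c *: v.
  have /(congr1 (fun f => (ip w w)^-1 *: f w)) := Zcomm _ (rank_one_bounded v w).
  by rewrite /= ZZ !scalerA mulVf // scale1r mulrC.
exists c.
  apply/eqP; rewrite -(@eqrXn2 _ 2) // ?expr1n.
  have := Zi w w; rewrite Zc dnormZ => /(canRL (mulfK ww)) ->.
  by rewrite mulfV.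
apply/funext => u; rewrite VZ /= Zc scalrfctE.
have [Ul _ _] := uU.
by rewrite -[X in U X]addr0 Ul (linear_map0 Ul) addr0.
Qed.

End unitaries.

(** * Operators on an invariant domain *)

Section domain_operators.
Context (R : realType) (H : completeNormedModType R[i]).
Variable ip : {dot H for Num.conj}.
Context (P : {pred H}) (D : subLmodType P).

(** Unitaries that restrict to bijections of the domain: exactly those by which
    operators with domain [D] can be conjugated. *)
Definition dunitary (U : H -> H) := unitary ip U /\ stable ip D U.

Let dot := dotD ip (D := D).

Lemma val_linear c (u v : D) : val (c *: u + v) = c *: val u + val v :> H.
Proof. exact: linearP. Qed.

Lemma val_scale c (u : D) : val (c *: u) = c *: val u :> H.
Proof. exact: linearZ. Qed.

Lemma dotDC (u v : D) : dot u v = Num.conj (dot v u).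
Proof. exact: ipC. Qed.

Lemma dotDP w : linear_for *%R (dot^~ w).
Proof. by move=> c u v; rewrite /dot /dotD val_linear ipP. Qed.

Lemma dotD_eq0 (u : D) : dot u u = 0 -> u = 0.
Proof. by move=> /ip_eq0 u0; apply: val_inj; rewrite u0 raddf0. Qed.

Lemma val_restr (U : H -> H) (v : D) : stable ip D U -> val (restr U v) = U (val v).
Proof. by move=> sU; rewrite /restr insubdK //; have [] := sU v. Qed.

Lemma mem_domain u : u \in P -> exists v : D, val v = u.
Proof. by move=> uP; exists (Sub u uP); rewrite SubK. Qed.

Lemma dunitary_id : dunitary idfun.
Proof.
by split; [exact: unitary_id | move=> v; rewrite adj_id; split; exact: valP].
Qed.

Lemma dunitary_comp U V : dunitary U -> dunitary V -> dunitary (U \o V).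
Proof.
move=> [uU sU] [uV sV]; split; first exact: unitary_comp.
move=> v; rewrite adj_unitary_comp//; split => /=.
- by have [/mem_domain[w <-] _] := sV v; have [] := sU w.
- by have [_ /mem_domain[w <-]] := sU v; have [] := sV w.
Qed.

Lemma dunitary_adj U : dunitary U -> dunitary (adj ip U).
Proof.
move=> [uU sU]; split; first exact: unitary_adj.
by move=> v; rewrite adj_unitaryK//; have [] := sU v.
Qed.

Lemma dunitary_scale (c : R[i]) U : `|c| = 1 -> dunitary U -> dunitary (c *: U).
Proof.
move=> c1 [uU sU]; have [uc ac] := unitary_scale c1 uU; split => // v.
rewrite ac !scalrfctE; have [/mem_domain[w <-] /mem_domain[w' <-]] := sU v.
by rewrite -!val_scale; split; exact: valP.
Qed.

Lemma restr_comp U V : dunitary U -> dunitary V ->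
  restr (D := D) (U \o V) = restr U \o restr V.
Proof.
move=> dU dV; have [_ sUV] := dunitary_comp dU dV.
case: dU dV => [_ sU] [_ sV].
by apply/funext => v; apply: val_inj; rewrite /= !val_restr.
Qed.

Lemma restr_id : restr idfun = idfun :> (D -> D).
Proof.
by apply/funext => v; apply: val_inj; rewrite val_restr//; case: dunitary_id.
Qed.

Lemma restr_linear U : dunitary U -> linear (restr (D := D) U).
Proof.
move=> [[Ul _ _] sU] c u v; apply: val_inj.
by rewrite val_linear !val_restr // val_linear Ul.
Qed.

Lemma restrK U : dunitary U -> cancel (restr (D := D) U) (restr (adj ip U)).
Proof.
move=> dU v; have [_ s'] := dunitary_adj dU; case: dU => uU sU.
by apply: val_inj; rewrite !val_restr//; have [-> _ _] := unitary_inverse uU.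
Qed.

Lemma restrVK U : dunitary U -> cancel (restr (adj ip U)) (restr (D := D) U).
Proof.
move=> dU v; have [_ s'] := dunitary_adj dU; case: dU => uU sU.
by apply: val_inj; rewrite !val_restr//; have [_ -> _] := unitary_inverse uU.
Qed.

Lemma restr_adjoint U : dunitary U -> adjoint_pair dot (restr U) (restr (adj ip U)).
Proof.
move=> dU u v; have [_ s'] := dunitary_adj dU; case: dU => uU sU.
by rewrite /dot /dotD !val_restr//; have [_ _ ->] := unitary_inverse uU.
Qed.

Lemma uconj_comp U V : dunitary U -> dunitary V -> forall x : D -> D,
  uconj ip (U \o V) x = uconj ip U (uconj ip V x).
Proof.
move=> dU dV x; have [uU _] := dU; have [uV _] := dV.
rewrite /uconj restr_comp// adj_unitary_comp//.
by rewrite (restr_comp (dunitary_adj dV) (dunitary_adj dU)).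
Qed.

Lemma uconj_id (x : D -> D) : uconj ip idfun x = x.
Proof. by rewrite /uconj adj_id restr_id. Qed.

Lemma uconjK U : dunitary U -> cancel (uconj (D := D) ip U) (uconj ip (adj ip U)).
Proof.
move=> dU x; apply/funext => v; rewrite /uconj /= adj_unitaryK; last by case: dU.
by rewrite !restrK.
Qed.

Lemma uconjM U (x y : D -> D) : dunitary U ->
  uconj ip U (x \o y) = uconj ip U x \o uconj ip U y.
Proof. by move=> dU; apply/funext => v; rewrite /uconj /= restrK. Qed.

Lemma uconjP U : dunitary U -> linear (uconj (D := D) ip U).
Proof.
move=> dU c x y; apply/funext => v.
by rewrite /uconj /= !(addrfctE, scalrfctE) /= restr_linear.
Qed.

Lemma uconj0 U : dunitary U -> uconj (D := D) ip U 0 = 0.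
Proof. by move=> dU; apply: linear_map0; exact: uconjP. Qed.

Lemma uconjD U (x y : D -> D) : dunitary U ->
  uconj ip U (x + y) = uconj ip U x + uconj ip U y.
Proof. by move=> dU; rewrite -[x]scale1r uconjP // !scale1r. Qed.

Lemma uconjZ U c (x : D -> D) : dunitary U ->
  uconj ip U (c *: x) = c *: uconj ip U x.
Proof. by move=> dU; rewrite -[c *: x]addr0 uconjP // uconj0// addr0. Qed.

Lemma uconj_sum U (I : Type) (r : seq I) (F : I -> D -> D) : dunitary U ->
  uconj ip U (\sum_(l <- r) F l) = \sum_(l <- r) uconj ip U (F l).
Proof.
move=> dU; apply: (big_morph (uconj ip U)); last exact: uconj0.
by move=> x y; exact: uconjD.
Qed.

Lemma uconj_linear U (x : D -> D) : dunitary U -> linear x -> linear (uconj ip U x).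
Proof.
move=> dU lx; apply: linear_map_comp; last exact/restr_linear/dunitary_adj.
by apply: linear_map_comp => //; exact: restr_linear.
Qed.

Lemma uconj_adj U (x : D -> D) : dunitary U ->
  adj dot (uconj ip U x) = uconj ip U (adj dot x).
Proof.
move=> dU; apply: (adj_conjugate dotDC dotDP dotD_eq0).
- exact: restrK.
- exact: restrVK.
- exact: restr_adjoint.
- exact/linear_map0/restr_linear.
Qed.

Lemma uconj_adjoint_pair U (x y : D -> D) : dunitary U ->
  adjoint_pair dot x y -> adjoint_pair dot (uconj ip U x) (uconj ip U y).
Proof.
move=> dU xy u v; rewrite /uconj /= (restr_adjoint dU) xy.
by rewrite (adjoint_pairC dotDC (restr_adjoint dU)).
Qed.

(** The phase of an implementing unitary disappears in the conjugation; linear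
    operators are needed to move it through [x]. *)
Lemma uconj_scale (c : R[i]) U (x : D -> D) : `|c| = 1 -> dunitary U ->
  linear x -> uconj ip (c *: U) x = uconj ip U x.
Proof.
move=> c1 dU lx; have dcU := dunitary_scale c1 dU.
have [uU sU] := dU; have [_ scU] := dcU.
have cc : c * Num.conj c = 1 by rewrite -normCK c1 expr1n.
have [_ acU] := unitary_scale c1 uU.
have [_ sV] := dunitary_adj dU; have [_ scV] := dunitary_adj dcU.
have rc v : restr (c *: U) v = c *: restr U v :> D.
  by apply: val_inj; rewrite val_scale !val_restr.
have rc' v : restr (adj ip (c *: U)) v = Num.conj c *: restr (adj ip U) v :> D.
  by apply: val_inj; rewrite val_scale !val_restr// acU.
have lr := restr_linear dU.
apply/funext => v; rewrite /uconj /= rc rc'.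
rewrite -[X in x X]addr0 lx (linear_map0 lx) lr (linear_map0 lr) !addr0.
by rewrite scalerA cc scale1r.
Qed.

Hypothesis ip_norm : forall u : H, `|u| ^+ 2 = ip u u.

(** A chosen implementer leaves the domain stable as soon as some implementer
    does, because they differ by a phase. *)
Lemma implementer_spec (theta : (H -> H) -> (H -> H)) U :
  implements ip theta U -> stable ip D U ->
  implements ip theta (implementer ip theta) /\ stable ip D (implementer ip theta).
Proof.
move=> iU sU.
have i' : implements ip theta (implementer ip theta).
  exact: (xgetPex (idfun : H -> H) (ex_intro _ U iU)).
split => //; have [c c1 ->] := implements_phase ip_norm iU i'.
by have [_] := dunitary_scale c1 (conj (proj1 iU) sU).
Qed.

Lemma act_implements (theta : (H -> H) -> (H -> H)) U (x : D -> D) :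
  implements ip theta U -> stable ip D U -> linear x ->
  act ip theta x = uconj ip U x.
Proof.
move=> iU sU lx; have [i' _] := implementer_spec iU sU.
rewrite /act; have [c c1 ->] := implements_phase ip_norm iU i'.
by rewrite uconj_scale //; split => //; case: iU.
Qed.

(** The largest *-algebra of operators with domain [D]. *)
Lemma adjointable_opalg :
  star_opalg ip [set x : D -> D | exists y, adjoint_pair dot x y].
Proof.
have adjE x y : adjoint_pair dot x y -> adj dot x = y.
  exact: (adjoint_pair_adj dotDC dotDP dotD_eq0).
split => /=.
- move=> x [y xy]; rewrite -/dot (adjE _ _ xy); split => //.
    exact: (adjoint_pair_linear dotDC dotDP dotD_eq0 xy).
  by exists x; exact: (adjoint_pairC dotDC).
- exists 0 => u v; rewrite (_ : (0 : D -> D) u = 0)// (_ : (0 : D -> D) v = 0)//.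
  by rewrite /dot /dotD raddf0 linear0l linear0r.
- move=> c x y [x' xx'] [y' yy']; exists (Num.conj c *: x' + y') => u v.
  rewrite !(addrfctE, scalrfctE) /= dotDP xx' yy'.
  by rewrite [RHS]dotDC dotDP rmorphD rmorphM /= conjCK -!dotDC.
- move=> x y [x' xx'] [y' yy']; exists (y' \o x') => u v /=.
  by rewrite xx' yy'.
Qed.

Lemma sub_generated (S : set (D -> D)) : S `<=` generated ip S.
Proof. exact: sub_gen_smallest. Qed.

(** A generated algebra is an intersection of *-algebras; the point is that the
    intersection is over a nonempty family, since it contains the algebra of all
    adjointable operators. *)
Lemma generated_opalg (S : set (D -> D)) :
  S `<=` [set x | exists y, adjoint_pair dot x y] -> star_opalg ip (generated ip S).
Proof.
move=> Sadj; split.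
- move=> x Sx; have [+ _ _ _] := adjointable_opalg => /(_ x)[].
    by apply: Sx; split => //; exact: adjointable_opalg.
  move=> lx _ xx; split => // N nN.
  by have [[NL _ _ _] _] := nN; have [] := NL _ (Sx _ nN).
- by move=> N [[]].
- by move=> c x y Sx Sy N nN; have [[_ _ + _] _] := nN; apply; [exact: Sx|exact: Sy].
- by move=> x y Sx Sy N nN; have [[_ _ _ +] _] := nN; apply; [exact: Sx|exact: Sy].
Qed.

(** Conjugation is a *-homomorphism, so it suffices to know where it sends the
    generators. *)
Lemma generated_uconj (S N : set (D -> D)) U : dunitary U ->
  S `<=` [set x | exists y, adjoint_pair dot x y] -> star_opalg ip N ->
  (forall x, S x -> N (uconj ip U x)) ->
  forall x, generated ip S x -> N (uconj ip U x).
Proof.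
move=> dU Sadj Nalg SN x Sx.
have [genL gen0 genP genM] := generated_opalg Sadj.
have [NL N0 NP NM] := Nalg.
suff [] : (generated ip S `&` [set x | N (uconj ip U x)]) x by [].
apply: Sx; split; last by move=> y Sy; split; [exact: sub_generated|exact: SN].
split => /=.
- move=> y [Sy Ny]; have [ly Say yay] := genL _ Sy; split => //; split => //.
  by rewrite /= -uconj_adj//; have [] := NL _ Ny.
- by rewrite uconj0.
- by move=> c y z [Sy Ny] [Sz Nz]; split; [exact: genP|rewrite uconjP//; exact: NP].
- by move=> y z [Sy Ny] [Sz Nz]; split; [exact: genM|rewrite uconjM//; exact: NM].
Qed.

Section opalg_closure.
Context (N : set (D -> D)) (Nalg : star_opalg ip N).

Lemma opalg_linear x : N x -> linear x.
Proof. by have [NL _ _ _] := Nalg => /NL[]. Qed.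

Lemma opalg_adjointable x : N x -> exists y, adjoint_pair dot x y.
Proof. by have [NL _ _ _] := Nalg => /NL[_ _ ?]; exists (adj dot x). Qed.

Lemma opalgD x y : N x -> N y -> N (x + y).
Proof. by have [_ _ NP _] := Nalg => Nx Ny; rewrite -[x]scale1r; exact: NP. Qed.

Lemma opalgZ c x : N x -> N (c *: x).
Proof. by have [_ N0 NP _] := Nalg => Nx; rewrite -[c *: x]addr0; exact: NP. Qed.

Lemma opalg_sum (I : Type) (r : seq I) (F : I -> D -> D) :
  (forall l, N (F l)) -> N (\sum_(l <- r) F l).
Proof.
by have [_ N0 NP _] := Nalg => NF; apply: (big_ind N) => //; exact: opalgD.
Qed.

End opalg_closure.
End domain_operators.

(** * Dominated series of complex functions *)

Section complex_series.
Context (R : realType).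
Local Notation C := (R[i] : numFieldType).
Local Notation Re := (@complex.Re R).
Local Notation Im := (@complex.Im R).

Lemma Re_continuous : continuous (Re : C -> R).
Proof.
move=> z; apply/(@cvgrPdist_lt _ _ _ (nbhs z)) => e e0.
have e0' : 0 < e%:C by rewrite ltcR.
near=> w.
have zw : `|z - w| < e%:C by near: w; exact: (@cvgr_dist_lt _ _ _ _ _ (@id C)).
by rewrite -raddfB -ltcR (le_lt_trans (normc_ge_Re _)).
Unshelve. all: by end_near. Qed.

Lemma real_complex_continuous : continuous (fun x : R => x%:C : C).
Proof.
move=> x; apply/(@cvgrPdist_lt _ _ _ (nbhs x)) => e e0.
have eR : e = (Re e)%:C by rewrite RRe_real// gtr0_real.
have e0' : 0 < Re e by rewrite -ltcR -eR.
near=> y.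
have xy : `|x - y| < Re e by near: y; exact: (@cvgr_dist_lt _ _ _ _ _ (@id R)).
by rewrite -rmorphB normc_def /= expr0n /= addr0 sqrtr_sqr eR ltcR.
Unshelve. all: by end_near. Qed.

(** Comparison test over [R[i]], reduced to the real and imaginary parts. *)
Lemma complex_series_cvg (u b : nat -> C) :
  (forall n, `|u n| <= b n) -> cvgn (series b) -> cvgn (series u).
Proof.
move=> ub cb.
have cRb : cvgn (series (fun n => Re (b n))).
  apply/cvg_ex; exists (Re (limn (series b))).
  rewrite (_ : series _ = Re \o series b); last first.
    by apply/funext => n; rewrite /series /= raddf_sum.
  by apply: continuous_cvg; [exact: Re_continuous|exact: cb].
have rb n : 0 <= b n by exact: le_trans (ub n).
have Rb0 n : 0 <= Re (b n) by rewrite -lecR RRe_real ?ger0_real.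
have part (f : R[i] -> R) : (forall z, `|f z|%:C <= `|z|) ->
    cvgn (series (fun n => f (u n))).
  move=> fz; apply: normed_cvg; apply: series_le_cvg cRb => // n.
    exact: normr_ge0.
  by rewrite -lecR (RRe_real (ger0_real (rb n))) (le_trans (fz _)).
have cRe := part (Re) (@normc_ge_Re R).
have cIm : cvgn (series (fun n => Im (u n))).
  apply: part => z; rewrite -normrN -ReiNIm.
  rewrite (le_trans (normc_ge_Re _))// normrM [X in _ * X]normc_def /=.
  by rewrite expr0n expr1n add0r sqrtr1 mulr1.
have cC (v : nat -> R) : cvgn (series v) ->
    (fun n => (series v n)%:C : C) @ \oo --> ((limn (series v))%:C : C).
  move=> cv; apply: (@continuous_cvg _ _ _ _ _ (series v) (fun x : R => x%:C : C)).
    exact: real_complex_continuous.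
  exact: cv.
have -> : series u = (fun n => (series (fun n => Re (u n)) n)%:C : C) +
    cst ('i%C : C) * (fun n => (series (fun n => Im (u n)) n)%:C : C).
  apply/funext => n; rewrite addrfctE mulrfctE /series /= !rmorph_sum mulr_sumr.
  by rewrite -big_split; apply: eq_bigr => k _; exact: complexE.
exact: cvgP _ (cvgD (cC _ cRe) (cvgM (cvg_cst _) (cC _ cIm))).
Qed.

(** Weierstrass test: the tails of the series are small uniformly in [t], so
    continuity of one partial sum near a point gives continuity of the sum. *)
Lemma continuous_complex_series (T : topologicalType) (g : nat -> T -> C)
    (b : nat -> C) :
  (forall n, continuous (g n)) -> (forall n t, `|g n t| <= b n) ->
  cvgn (series b) -> continuous (fun t => limn (series (g^~ t))).
Proof.
move=> gc gb cb t; apply/(@cvgrPdist_lt _ _ _ (nbhs t)) => e e0.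
have e5 : 0 < e / 5 by rewrite divr_gt0.
have cg s : cvgn (series (g^~ s)).
  by apply: (complex_series_cvg (b := b)) => // n; exact: gb.
have [N _ hN] : \forall n \near \oo, forall m, (n <= m)%N ->
    forall s, `|series (g^~ s) m - series (g^~ s) n| < e / 5.
  have /cvg_cauchy/cauchy_seriesP/(_ _ e5)[[A B] [[n1 _ An1] [n2 _ Bn2]] AB] := cb.
  exists (maxn n1 n2) => // n /=; rewrite geq_max => /andP[n1n n2n] m nm s.
  have : `|\sum_(n <= k < m) b k| < e / 5.
    apply: (AB (n, m)); split; first exact: An1.
    by apply: Bn2 => /=; exact: leq_trans nm.
  apply: le_lt_trans.
  rewrite sub_series_geq// [leRHS]ger0_norm; last first.
    by apply: sumr_ge0 => k _; exact: le_trans (normr_ge0 _) (gb k s).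
  by apply: le_trans (ler_norm_sum _ _ _) _; exact: ler_sum.
have {}hN s : `|limn (series (g^~ s)) - series (g^~ s) N| < e / 5 + e / 5.
  have := @cvgr_dist_lt _ _ _ _ _ _ _ (cg s) _ e5.
  move=> [N' _ hN'].
  have /= h1 := hN' (maxn N N') (leq_maxr _ _).
  have h2 := hN N (leqnn _) (maxn N N') (leq_maxl _ _) s.
  rewrite -(subrKA (series (g^~ s) (maxn N N'))).
  by apply: le_lt_trans (ler_normD _ _) _; exact: ltrD.
have cN : (fun s => series (g^~ s) N) @ t --> series (g^~ t) N.
  rewrite /series /=; apply: (@cvg_big _ nat +%R 0 xpredT _ T (nbhs t) _ g).
    by move=> z; apply: (@cvgD _ _ _ (nbhs z)); [exact: cvg_fst | exact: cvg_snd].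
  by move=> k _; exact: gc.
near=> s.
have hs : `|series (g^~ t) N - series (g^~ s) N| < e / 5.
  by near: s; exact: (@cvgr_dist_lt _ _ _ (nbhs t)).
have := ltrD (hN t) (ltrD hs (hN s)).
have -> : e / 5 + e / 5 + (e / 5 + (e / 5 + e / 5)) = e by field.
apply: le_lt_trans.
have -> : limn (series (g^~ t)) - limn (series (g^~ s)) =
    (limn (series (g^~ t)) - series (g^~ t) N) +
    ((series (g^~ t) N - series (g^~ s) N) +
     (series (g^~ s) N - limn (series (g^~ s)))) by rewrite !subrKA.
apply: le_trans (ler_normD _ _) _; rewrite lerD2l.
by apply: le_trans (ler_normD _ _) _; rewrite lerD2l distrC.
Unshelve. all: by end_near. Qed.

End complex_series.

(** * Perturbation of an automorphism group by a cocycle *)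

Section perturbed_group.
Context (R : realType) (H : completeNormedModType R[i]).
Variable ip : {dot H for Num.conj}.
Hypothesis ip_norm : forall u : H, `|u| ^+ 2 = ip u u.
Local Notation C := (R[i] : numFieldType).

Lemma bconj_bounded U a : unitary ip U -> bounded_op a -> bounded_op (bconj ip U a).
Proof.
move=> uU ba; apply: bounded_comp; last exact/unitary_bounded/unitary_adj.
by apply: bounded_comp => //; exact: unitary_bounded.
Qed.

Lemma bconj_comp U V a : unitary ip U -> unitary ip V ->
  bconj ip (U \o V) a = bconj ip U (bconj ip V a).
Proof. by move=> uU uV; rewrite /bconj adj_unitary_comp. Qed.

Lemma bconj_id a : bconj ip idfun a = a.
Proof. by rewrite /bconj adj_id. Qed.

Lemma unitary_bconj U V : unitary ip U -> unitary ip V -> unitary ip (bconj ip U V).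
Proof.
by move=> uU uV; apply: unitary_comp; [exact: unitary_comp|exact: unitary_adj].
Qed.

Lemma bconj_automorphism U : unitary ip U -> star_automorphism ip (bconj ip U).
Proof.
move=> uU; have uU' := unitary_adj uU; have [UK VK UV] := unitary_inverse uU.
have comp_id (V V' : H -> H) : cancel V' V -> V \o V' = idfun.
  by move=> VV'; apply/funext => u /=; rewrite VV'.
split.
- split.
  + by move=> a ba; exact: bconj_bounded.
  + move=> a b _ _ /(congr1 (bconj ip (adj ip U))).
    by rewrite -!bconj_comp// (comp_id _ _ UK) !bconj_id.
  + move=> a ba; exists (bconj ip (adj ip U) a); first exact: bconj_bounded.
    by rewrite -bconj_comp// (comp_id _ _ VK) bconj_id.
- move=> c a b _ _; have [Ul _ _] := uU; apply/funext => u.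
  by rewrite /bconj /= !(addrfctE, scalrfctE) /= Ul.
- by move=> a b _ _; apply/funext => u; rewrite /bconj /= UK.
- move=> a _; rewrite /bconj.
  rewrite (adj_conjugate (@ipC _ _ ip) (@ipP _ _ ip) (@ip_eq0 _ _ ip))//.
  by apply: linear_map0; case: uU.
Qed.

Lemma star_automorphism_comp theta theta' : star_automorphism ip theta ->
  star_automorphism ip theta' -> star_automorphism ip (theta \o theta').
Proof.
move=> [tbij tlin tmul tstar] [tbij' tlin' tmul' tstar'].
have t'b a : bounded_op a -> bounded_op (theta' a) by have [+ _ _] := tbij'; apply.
split => /=.
- exact: set_bij_comp tbij' tbij.
- by move=> c a b ba bb; rewrite tlin'// tlin//; exact: t'b.
- by move=> a b ba bb; rewrite tmul'// tmul//; exact: t'b.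
- by move=> a ba; rewrite tstar'// tstar//; exact: t'b.
Qed.

(** For unitaries, [|W_t^* u - W_s^* u| = |W_s v - W_t v|] with [v = W_t^* u], so
    strong continuity passes to the adjoints. *)
Lemma adj_strongly_continuous (W : R -> H -> H) :
  (forall t, unitary ip (W t)) -> (forall u, continuous (W^~ u)) ->
  forall u, continuous (fun t => adj ip (W t) u).
Proof.
move=> uW cW u t; apply/(@cvgrPdist_lt _ _ _ (nbhs t)) => e e0.
have [tK tVK _] := unitary_inverse (uW t).
near=> s; have [sK sVK _] := unitary_inverse (uW s).
rewrite -(unitary_norm ip_norm _ (uW s)).
have [Wl _ _] := uW s.
have -> : W s (adj ip (W t) u - adj ip (W s) u) =
    W s (adj ip (W t) u) - W t (adj ip (W t) u).
  rewrite tVK -[in RHS](sVK u) addrC -scaleN1r Wl scaleN1r addrC.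
  by rewrite sVK.
rewrite distrC.
by near: s; apply: (@cvgr_dist_lt _ _ _ (nbhs t)) => //; exact: cW.
Unshelve. all: by end_near. Qed.

(** Weak continuity of a uniformly bounded family [A] allows its arguments to
    move continuously: the error is at most
    [c |v t - v s| |w s| + c |v t| |w t - w s|] plus the weak increment of [A]. *)
Lemma matrix_element_continuous (A : R -> H -> H) (c : C) (v w : R -> H) :
  0 <= c -> (forall t, linear (A t)) -> (forall t u, `|A t u| <= c * `|u|) ->
  (forall x y, continuous (fun t => ip (A t x) y : C)) ->
  continuous v -> continuous w ->
  continuous (fun t => ip (A t (v t)) (w t) : C).
Proof.
move=> c0 Al Ac Acont cv cw t; apply/(@cvgrPdist_lt _ _ _ (nbhs t)) => e e0.
have e3 : 0 < e / 3 by rewrite divr_gt0.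
(* [k] dominates [c |v t|] and [c |w s|] for [s] near [t]; the last [+ 1] makes
   it positive. *)
pose k := c * (`|w t| + 1 + `|v t|) + 1.
have k0 : 0 < k by rewrite ltr_wpDl// mulr_ge0// !addr_ge0.
have ek : 0 < e / 3 / k by rewrite divr_gt0.
near=> s.
have h1 : `|v t - v s| < e / 3 / k.
  by near: s; apply: (@cvgr_dist_lt _ _ _ (nbhs t)) => //; exact: cv.
have h2 : `|w t - w s| < e / 3 / k.
  by near: s; apply: (@cvgr_dist_lt _ _ _ (nbhs t)) => //; exact: cw.
have h2' : `|w t - w s| < 1.
  by near: s; apply: (@cvgr_dist_lt _ _ _ (nbhs t)) => //; exact: cw.
have h3 : `|ip (A t (v t)) (w t) - ip (A s (v t)) (w t)| < e / 3.
  near: s.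
  apply: (@cvgr_dist_lt _ _ _ (nbhs t) _
    (fun s => ip (A s (v t)) (w t) : C)) => //.
  exact: Acont.
have ws : `|w s| <= `|w t| + 1.
  rewrite -[w s](subKr (w t)) (le_trans (ler_normB _ _))// lerD2l.
  exact: ltW.
have -> : ip (A t (v t)) (w t) - ip (A s (v s)) (w s) =
    (ip (A t (v t)) (w t) - ip (A s (v t)) (w t)) +
    (ip (A s (v t)) (w t - w s) + ip (A s (v t - v s)) (w s)).
  have -> : A s (v t - v s) = A s (v t) - A s (v s).
    by rewrite addrC -scaleN1r Al scaleN1r addrC.
  by rewrite linearBr linearBl /= !subrKA.
have -> : e = e / 3 + (e / 3 + e / 3) by field.
apply: le_lt_trans (ler_normD _ _) _; apply: ltrD => //.
apply: le_lt_trans (ler_normD _ _) _; apply: ltrD.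
  apply: le_lt_trans (ip_CauchySchwarz ip_norm _ _) _.
  apply: (@le_lt_trans _ _ (k * `|w t - w s|)); last first.
    by rewrite mulrC -ltr_pdivlMr.
  apply: ler_wpM2r => //; apply: le_trans (Ac _ _) _.
  rewrite /k mulrDr -addrA addrC -addrA lerDl.
  by rewrite addr_ge0// mulr_ge0// addr_ge0.
apply: le_lt_trans (ip_CauchySchwarz ip_norm _ _) _.
apply: (@le_lt_trans _ _ (k * `|v t - v s|)); last first.
  by rewrite mulrC -ltr_pdivlMr.
apply: (@le_trans _ _ (c * `|v t - v s| * (`|w t| + 1))).
  by apply: ler_pM.
rewrite mulrAC; apply: ler_wpM2r => //.
rewrite /k [c * (_ + `|v t|)]mulrDr -addrA lerDl.
by rewrite addr_ge0// mulr_ge0.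
Unshelve. all: by end_near. Qed.

Lemma series_head (z : C) : series (fun n => if n is 0%N then z else 0) @ \oo --> z.
Proof.
apply: cvg_near_cst; exists 1%N => // -[|n] //= _.
rewrite /series /= big_nat_recl// big1_seq ?addr0//.
Qed.

(** A single matrix element is the sum of a series with one nonzero term. *)
Lemma wstar_continuous_weak (f : R -> H -> H) : wstar_continuous ip f ->
  forall x y, continuous (fun t => ip (f t x) y : C).
Proof.
move=> wf x y.
pose delta (u : H) n := if n is 0%N then u else 0.
have cd u : cvgn (series (fun n => `|delta u n| ^+ 2)).
  have -> : (fun n => `|delta u n| ^+ 2) =
      (fun n => if n is 0%N then `|u| ^+ 2 else 0).
    by apply/funext => -[|n] //=; rewrite normr0 expr0n.
  by apply/cvg_ex; exists (`|u| ^+ 2 : C); exact: series_head.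
have := wf _ _ (cd x) (cd y).
rewrite (_ : (fun t => limn _) = (fun t => ip (f t x) y))//.
apply/funext => t; apply: cvg_lim => //.
have -> : (fun n => ip (f t (delta x n)) (delta y n)) =
    (fun n => if n is 0%N then ip (f t x) y else 0).
  by apply/funext => -[|n] //=; rewrite linear0r.
exact: series_head.
Qed.

(** Moving [W_t] onto the vectors, the [n]-th term becomes the matrix element of
    [A t] at [W_t^* xi_n] and [W_t^* eta_n].  Its modulus is bounded, uniformly in
    [t], by [c |xi_n| |eta_n|], hence by a summable sequence. *)
Lemma wstar_continuous_bconj (A W : R -> H -> H) (c : C) :
  0 <= c -> (forall t, linear (A t)) -> (forall t u, `|A t u| <= c * `|u|) ->
  wstar_continuous ip A ->
  (forall t, unitary ip (W t)) -> (forall u, continuous (W^~ u)) ->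
  wstar_continuous ip (fun t => bconj ip (W t) (A t)).
Proof.
move=> c0 Al Ac wA uW cW xi eta cxi ceta.
have cW' := adj_strongly_continuous uW cW.
pose b n : C := c * (`|xi n| ^+ 2 + `|eta n| ^+ 2).
have cb : cvgn (series b).
  rewrite (_ : series b = cst (c : C) * (series (fun n => `|xi n| ^+ 2) +
                                 series (fun n => `|eta n| ^+ 2))).
    exact: cvgP _ (cvgM (cvg_cst _) (cvgD cxi ceta)).
  apply/funext => n; rewrite mulrfctE addrfctE /series /= -big_split mulr_sumr.
  exact: eq_bigr.
apply: (continuous_complex_series
  (g := fun n t => ip (bconj ip (W t) (A t) (xi n)) (eta n)) _ _ cb) => [n|n t].
  rewrite (_ : (fun t => _) =
    (fun t => ip (A t (adj ip (W t) (xi n))) (adj ip (W t) (eta n)) : C)).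
    exact: (matrix_element_continuous c0 Al Ac (wstar_continuous_weak wA)
             (cW' (xi n)) (cW' (eta n))).
  apply/funext => t; rewrite /bconj /=.
  by have [_ _ ->] := unitary_inverse (uW t).
apply: le_trans (ip_CauchySchwarz ip_norm _ _) _.
rewrite /bconj /= (unitary_norm ip_norm) //.
apply: (@le_trans _ _ (c * `|xi n| * `|eta n|)).
  apply: ler_wpM2r => //; apply: le_trans (Ac _ _) _.
  by rewrite (unitary_norm ip_norm) //; exact: unitary_adj.
rewrite -mulrA /b; apply: ler_wpM2l => //.
rewrite -subr_ge0.
have : 0 <= `|xi n| ^+ 2 + `|eta n| ^+ 2 by rewrite addr_ge0// exprn_ge0.
have xir := normr_real (xi n); have etar := normr_real (eta n).
have sq : 0 <= (`|xi n| - `|eta n|) ^+ 2.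
  by rewrite real_exprn_even_ge0// rpredB.
move=> s0; rewrite -(pmulr_rge0 _ (ltr0n _ 2 : 0 < (2 : C))).
rewrite (_ : 2 * _ = (`|xi n| - `|eta n|) ^+ 2 + (`|xi n| ^+ 2 + `|eta n| ^+ 2)).
  by rewrite addr_ge0.
by ring.
Qed.

Context (alpha : R -> (H -> H) -> (H -> H)) (W : R -> H -> H).
Hypothesis alpha_group : automorphism_group ip alpha.
Hypothesis alpha_impl : forall t, exists U, implements ip (alpha t) U.
Hypothesis W_unitary : forall t, unitary ip (W t).
Hypothesis W_continuous : forall u : H, continuous (W^~ u).
Hypothesis W_cocycle : forall t s, W (t + s) = W t \o alpha t (W s).

Lemma cocycle0 : W 0 = idfun.
Proof.
have [_ a0 _ _] := alpha_group.
have := W_cocycle 0 0; rewrite addr0 a0; last exact: unitary_bounded.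
move=> W00; apply/funext => u; have [WK _ _] := unitary_inverse (W_unitary 0).
by apply: (can_inj WK); exact: esym (congr1 (@^~ u) W00).
Qed.

(** The group law is the cocycle identity: with [b = alpha_s(a)],
    conjugating [alpha_t(b)] by [W_(t+s)] is conjugating by [W_t] the image under
    [alpha_t] of the conjugate of [b] by [W_s].  For the
    continuity, [alpha_t(a)] is bounded uniformly in [t] because [alpha_t] is
    implemented by unitaries. *)
Lemma perturbed_automorphism_group :
  automorphism_group ip (fun t a => bconj ip (W t) (alpha t a)).
Proof.
have [aut a0 aD aw] := alpha_group.
have ab t a : bounded_op a -> bounded_op (alpha t a).
  by have [[+ _ _] _ _ _] := aut t; apply.
split.
- by move=> t; apply: star_automorphism_comp => //; exact: bconj_automorphism.
- by move=> a ba; rewrite cocycle0 bconj_id a0.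
- move=> t s a ba; have [U [uU hU]] := alpha_impl t.
  have bW : bounded_op (W s) by exact: unitary_bounded.
  have bW' : bounded_op (adj ip (W s)) by exact/unitary_bounded/unitary_adj.
  have uaW : unitary ip (alpha t (W s)) by rewrite hU//; exact: unitary_bconj.
  rewrite W_cocycle bconj_comp// aD//.
  have [_ _ tM tstar] := aut t.
  have bas := ab s a ba.
  rewrite [in RHS]/bconj (tM _ _ (bounded_comp bW bas) bW') (tM _ _ bW bas).
  by rewrite (tstar _ bW).
- move=> a ba; have [la ca] := ba.
  have [c c0 hc] := continuous_linear_bound la ca.
  have lA t : linear (alpha t a) by have [] := ab t a ba.
  have cA t u : `|alpha t a u| <= c * `|u|.
    have [U [uU hU]] := alpha_impl t.
    rewrite hU// /bconj /= (unitary_norm ip_norm)//; apply: le_trans (hc _) _.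
    by rewrite (unitary_norm ip_norm)//; exact: unitary_adj.
  exact: (wstar_continuous_bconj c0 lA cA (aw a ba) W_unitary W_continuous).
Qed.

End perturbed_group.

(** * Degree and times of a cochain *)

Section graded_algebra.
Context (R : realType) (K : involutiveAlg R) (G : gradedAlg K).

(** Degree 1 is [K] itself: the universal property applied to the coordinate map
    on [K^1] gives an inverse of [gr1], since the composite with [gr1] and the
    identity solve the same universal problem. *)
Lemma gr1_surj (x : G 1%N) : exists k : K, x = gr1 G k.
Proof.
have ml : multilinear (fun f : 'I_1 -> K => f ord0).
  by move=> l f a u v; rewrite (ord1 l).
have [g [[gl gE] _]] := gr_tens_universal G (ltn0Sn 0) ml.
have tl : linear (gr1 G).
  move=> a u v; have := gr_tens_multilinear G (ltn0Sn 0) ord0 (fun=> 0) a u v.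
  have e (w : K) : ([eta (fun=> 0) with ord0 |-> w] : 'I_1 -> K) = (fun=> w).
    by apply/funext => l; rewrite (ord1 l).
  by rewrite !e.
have [h [_ hu]] := gr_tens_universal G (ltn0Sn 0) (gr_tens_multilinear G (ltn0Sn 0)).
exists (g x); rewrite -[LHS]/(id x) -[RHS]/((gr1 G \o g) x).
congr (_ x); rewrite -(hu id); last by split.
apply: hu; split; first exact: linear_map_comp.
move=> f /=; rewrite gE /gr1; congr gr_tens.
by apply/funext => l; rewrite (ord1 l).
Qed.

(** [K_(n+1)] is spanned by the products of [K_1] and [K_n], so additive
    statements need to be checked on degree 1 and on products with an element of
    degree 1 on the left. *)
Lemma graded_ind (Q : forall n, G n -> Prop) :
  (forall k, Q 1%N (gr1 G k)) ->
  (forall n, (0 < n)%N -> Q n 0) ->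
  (forall n, (0 < n)%N -> forall x y, Q n x -> Q n y -> Q n (x + y)) ->
  (forall n, (0 < n)%N -> forall (x : G 1%N) (y : G n),
     Q 1%N x -> Q n y -> Q (1 + n)%N (odot x y)) ->
  forall n, (0 < n)%N -> forall x : G n, Q n x.
Proof.
move=> Q1 Q0 QD QM; case=> // n _; elim: n => [|n IH] x.
  by have [k ->] := gr1_surj x.
have [m [y [z ->]]] := odot_span (ltn0Sn 0) (ltn0Sn n) (x : G (1 + n.+1)%N).
apply: (big_ind (Q (1 + n.+1)%N)); [exact: Q0|exact: QD|].
move=> l _; apply: QM => //.
by have [k ->] := gr1_surj (y l).
Qed.

End graded_algebra.

Section mass.
Context (R : realType).

(** A bound for the absolute values of all partial sums of the times
    [t_1, ..., t_n], hence for all the times at which a cochain evaluated at [t]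
    looks at the process. *)
Definition mass (n : nat) (t : 'rV[R]_n) : R := \sum_(l < n) `|t 0 l|.

Lemma mass_ge0 n (t : 'rV[R]_n) : 0 <= mass t.
Proof. by apply: sumr_ge0 => l _. Qed.

Lemma total_mass n (t : 'rV[R]_n) : `|Defs.total t| <= mass t.
Proof. exact: ler_norm_sum. Qed.

Lemma mass_split n m (t : 'rV[R]_(n + m)) :
  mass t = mass (lsubmx t) + mass (rsubmx t).
Proof.
by rewrite /mass big_split_ord /=; congr (_ + _); apply: eq_bigr => l _; rewrite mxE.
Qed.

Lemma mass_const (t : R) : mass (const_mx t : 'rV_1) = `|t|.
Proof. by rewrite /mass big_ord1 mxE. Qed.

Lemma row1E (t : 'rV[R]_1) : t = const_mx (t 0 0).
Proof. by apply/rowP => l; rewrite (ord1 l) mxE. Qed.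

End mass.

(** * The deformed process *)

Section deformation.
Context (R : realType) (H : completeNormedModType R[i]).
Context (ip : {dot H for Num.conj}) (ip_norm : forall u : H, `|u| ^+ 2 = ip u u).
Context (P : {pred H}) (D : subLmodType P) (K : involutiveAlg R) (G : gradedAlg K).
Context (alpha : R -> (H -> H) -> (H -> H)) (M : set (D -> D)).
Context (j : forall i, G i -> cochain D i) (hj : stationary_process ip alpha M j).
Context (W : R -> (H -> H)) (hW : multiplicative_cocycle ip D alpha W).

Local Notation alpha' := (fun t a => bconj ip (W t) (alpha t a)).
Local Notation A t := (act (D := D) ip (alpha t)).
Local Notation A' t := (act (D := D) ip (alpha' t)).
Local Notation w t := (uconj (D := D) ip (W t)).
Local Notation dot := (dotD ip (D := D)).

Lemma cocycle_dunitary t : dunitary ip D (W t).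
Proof. by split; [exact: (mc_unitary hW) | exact: (mc_stable hW)]. Qed.

Lemma group_implementer t : implements ip (alpha t) (implementer ip (alpha t)) /\
  stable ip D (implementer ip (alpha t)).
Proof.
have [[U iU sU] _] := sp_acts hj t; exact: (implementer_spec ip_norm iU sU).
Qed.

Lemma group_dunitary t : dunitary ip D (implementer ip (alpha t)).
Proof. by have [[uU _] sU] := group_implementer t. Qed.

Lemma group_bounded t a : bounded_op a -> bounded_op (alpha t a).
Proof.
by have [aut _ _ _] := sp_group hj; have [[+ _ _] _ _ _] := aut t; apply.
Qed.

Lemma actD t s x : linear x -> A (t + s) x = A t (A s x).
Proof.
have [[ut it] _] := group_implementer t; have [[us is_] _] := group_implementer s.
have dts := dunitary_comp (group_dunitary t) (group_dunitary s).
have [_ _ aD _] := sp_group hj.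
move=> lx; rewrite (act_implements ip_norm
  (U := implementer ip (alpha t) \o implementer ip (alpha s))) //.
- by rewrite uconj_comp//; exact: group_dunitary.
- split; first by case: dts.
  move=> a ba; rewrite aD// it; last exact: group_bounded.
  by rewrite is_// -bconj_comp.
- by case: dts.
Qed.

Lemma act0 x : linear x -> A 0 x = x.
Proof.
have [_ a0 _ _] := sp_group hj; have [u_id s_id] := dunitary_id ip D.
move=> lx; rewrite (act_implements ip_norm (U := idfun)) ?uconj_id//.
by split => // a ba; rewrite a0// bconj_id.
Qed.

Lemma act_linear t x : linear x -> linear (A t x).
Proof. exact/uconj_linear/group_dunitary. Qed.

Lemma act_zero t : A t 0 = 0.
Proof. exact/uconj0/group_dunitary. Qed.

Lemma act_add t x y : A t (x + y) = A t x + A t y.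
Proof. exact/uconjD/group_dunitary. Qed.

Lemma act_comp t x y : A t (x \o y) = A t x \o A t y.
Proof. exact/uconjM/group_dunitary. Qed.

(** The unitary [U_t] implementing [alpha_t] gives
    [W_(t+s) = W_t U_t W_s U_t^*]. *)
Lemma cocycle_act t s x : w (t + s) (A t x) = w t (A t (w s x)).
Proof.
have [[ut it] _] := group_implementer t.
rewrite (mc_cocycle hW) it; last exact/unitary_bounded/(mc_unitary hW).
have dU := group_dunitary t.
have dW := cocycle_dunitary.
have dUW := dunitary_comp dU (dW s); have dU' := dunitary_adj dU.
rewrite /bconj (uconj_comp (dW t) (dunitary_comp dUW dU')).
rewrite (uconj_comp dUW dU') (uconj_comp dU (dW s)).
by rewrite /act uconjK.
Qed.

Lemma deformed_implements t :
  implements ip (alpha' t) (W t \o implementer ip (alpha t)) /\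
  stable ip D (W t \o implementer ip (alpha t)).
Proof.
have [uWU sWU] := dunitary_comp (cocycle_dunitary t) (group_dunitary t).
have [[ut it] _] := group_implementer t.
split => //; split => // a ba.
by rewrite it// -bconj_comp//; exact: (mc_unitary hW).
Qed.

Lemma deformed_act t x : linear x -> A' t x = w t (A t x).
Proof.
have [i' s'] := deformed_implements t => lx.
rewrite (act_implements ip_norm i' s' lx) uconj_comp//.
- exact: cocycle_dunitary.
- exact: group_dunitary.
Qed.

Lemma deformed_dunitary t : dunitary ip D (implementer ip (alpha' t)).
Proof.
have [i' s'] := deformed_implements t.
by have [[u _] s] := implementer_spec ip_norm i' s'.
Qed.

(** This is where negative times come in.  At the times [s] and [-s] the relation
    [cocycle_act] reads [A_s x = w_s (A_s (w_(-s) x))], and [A_s x = w_s (A_s x)]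
    by hypothesis; [w_s] and [A_s] are injective. *)
Lemma cocycle_neg_fix s x : linear x -> w s (A s x) = A s x -> w (- s) x = x.
Proof.
move=> lx fx; have := cocycle_act s (- s) x; rewrite subrr.
rewrite (cocycle0 ip_norm (sp_group hj) (mc_unitary hW) (mc_cocycle hW)) uconj_id.
rewrite -{1}fx => e.
have eA : A s x = A s (w (- s) x) := can_inj (uconjK (cocycle_dunitary s)) e.
by rewrite -(can_inj (uconjK (group_dunitary s)) eA).
Qed.

Lemma process_mem i (x : G i) t : (0 < i)%N -> M (j x t).
Proof. by move=> i0; have [] := sp_cocycle hj i0 x. Qed.

Lemma process_linear i (x : G i) t : (0 < i)%N -> linear (j x t).
Proof. by move=> i0; exact: (opalg_linear (sp_algebra hj)) (process_mem _ _ i0). Qed.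

(** The additive cocycle identity in degree 1: the group shifts increments. *)
Lemma act_value1 (k : K) T t :
  A T (value1 j k t) = value1 j k (T + t) - value1 j k T.
Proof.
pose tau : 'rV[R]_2 := \row_(l < 2) (if l == ord0 then T else t).
have [_ /(congr1 (@^~ tau))] := sp_cocycle hj (ltn0Sn 0) (gr1 G k).
rewrite /differential big_ord1 /=.
have -> : tau 0 ord0 = T by rewrite mxE.
have -> : col' ord0 tau = const_mx t :> 'rV_1.
  by apply/rowP => l; rewrite !mxE.
have -> : col' ord_max tau = const_mx T :> 'rV_1.
  by apply/rowP => l; rewrite !mxE (ord1 l).
have -> : Defs.merge ord0 tau = const_mx (T + t) :> 'rV_1.
  by apply/rowP => l; rewrite !mxE (ord1 l).
rewrite expr1 scaleN1r sqrrN expr1n scale1r -/(value1 j k t).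
rewrite -/(value1 j k T) -/(value1 j k (T + t)) => /eqP.
by rewrite -addrA addr_eq0 opprD opprK => /eqP.
Qed.

Lemma value1_linear k t : linear (value1 j k t).
Proof. exact: process_linear. Qed.

Hypothesis hM : markovian ip j W.

Lemma increment_fix (k : K) s a b : 0 <= s -> s <= a -> s <= b ->
  w s (value1 j k a - value1 j k b) = value1 j k a - value1 j k b.
Proof.
move=> s0; wlog ba : a b / b <= a => [hwlog|] sa sb.
  have [ba|/ltW ab] := leP b a; first exact: hwlog.
  rewrite -opprB -scaleN1r uconjZ; last exact: cocycle_dunitary.
  by rewrite hwlog.
have [_ ->] := hM s0 => //; apply: sub_generated.
by exists k, b, a.
Qed.

(** The shift by [s] moves the increment between [T] and [T + t] after the time
    [s], where [w_s] acts trivially. *)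
Lemma value1_fix (k : K) s T t : 0 <= s -> 0 <= T -> 0 <= T + t ->
  w (- s) (A T (value1 j k t)) = A T (value1 j k t).
Proof.
move=> s0 T0 Tt0; apply: cocycle_neg_fix.
  exact/act_linear/value1_linear.
rewrite -actD; last exact: value1_linear.
by rewrite act_value1 increment_fix// -?addrA ?lerDl.
Qed.

(** After the shift by [T] all the times involved are nonnegative.  In the
    induction, a product at [(t_1, t')] shifted by [T] is the product of [j(x)(t_1)]
    shifted by [T] and [j(y)(t')] shifted by [T + t_1], and the second shift is
    still at least the mass of [t']. *)
Lemma shifted_fix i (x : G i) : (0 < i)%N -> forall t T s, mass t <= T -> 0 <= s ->
  w (- s) (A T (j x t)) = A T (j x t).
Proof.
move=> i0; move: i i0 x; apply: graded_ind.
- move=> k t T s tT s0; rewrite (row1E t) in tT *.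
  rewrite mass_const in tT; apply: value1_fix => //.
    exact: le_trans tT.
  by rewrite -lerBlDr sub0r (le_trans _ tT)// -normrN ler_norm.
- move=> n n0 t T s _ _; have := sp_linear hj n0 (-1) 0 0 t.
  rewrite scaler0 addr0 scaleN1r addNr => ->.
  by rewrite act_zero uconj0//; exact: cocycle_dunitary.
- move=> n n0 x y hx hy t T s tT s0.
  have := sp_linear hj n0 1 x y t; rewrite !scale1r => ->.
  by rewrite act_add uconjD ?hx ?hy//; exact: cocycle_dunitary.
- move=> n n0 x y hx hy t T s tT s0.
  rewrite (sp_cup hj)// /cup.
  rewrite act_comp -actD; last exact: process_linear.
  rewrite mass_split in tT.
  have xT : mass (lsubmx t) <= T by rewrite (le_trans _ tT)// lerDl mass_ge0.
  rewrite uconjM; last exact: cocycle_dunitary.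
  rewrite hx// hy//.
  have := total_mass (lsubmx t); rewrite ler_norml => /andP[h _].
  by rewrite (le_trans _ (lerD tT h))// addrC addKr.
Qed.

(** In degree 1 and for [t <= 0] this is the prescribed conjugation by [W_t]; in
    general [mass t] is merely one of the admissible times of
    [deformed_processE]. *)
Definition deformed_process i (x : G i) : cochain D i :=
  fun t => w (- mass t) (j x t).

Local Notation j' := deformed_process.

(** Put [m = mass t] and [T = m + s].  By [cocycle_act],
    [w_(-T) y = w_(-m) A_(-m) w_(-s) A_m y], and [w_(-s)] fixes [A_m y]. *)
Lemma deformed_processE i (x : G i) t T : (0 < i)%N -> mass t <= T ->
  w (- T) (j x t) = j' x t.
Proof.
move=> i0 tT; rewrite /j'; have lx := process_linear x t i0.
have -> : - T = - mass t - (T - mass t) by ring.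
rewrite -[in LHS](act0 lx) -(subrr (- mass t)) opprK actD//.
rewrite cocycle_act shifted_fix ?subr_ge0//.
by rewrite -actD// addNr act0.
Qed.

Lemma deformed_shift i (x : G i) t T s : (0 < i)%N -> mass t <= T + s ->
  w (- T) (A s (j x t)) = A' s (j' x t).
Proof.
move=> i0 tTs; have lx := process_linear x t i0.
rewrite -(deformed_processE x i0 tTs) deformed_act; last first.
  by apply: uconj_linear => //; exact: cocycle_dunitary.
by rewrite -cocycle_act opprD addrCA subrr addr0.
Qed.

Lemma deformed_linear i (c : R[i]) (x y : G i) t : (0 < i)%N ->
  j' (c *: x + y) t = c *: j' x t + j' y t.
Proof.
by move=> i0; rewrite /j' (sp_linear hj)// uconjP//; exact: cocycle_dunitary.
Qed.

Lemma deformed_cup i k (x : G i) (y : G k) : (0 < i)%N -> (0 < k)%N ->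
  j' (odot x y) = cup ip alpha' (j' x) (j' y).
Proof.
move=> i0 k0; apply/funext => t; rewrite /cup.
(* One time that is admissible for all three values in the product formula. *)
pose T := mass t + (mass (lsubmx t) + (mass (rsubmx t) + `|Defs.total (lsubmx t)|)).
have T1 : mass t <= T by rewrite lerDl !addr_ge0// ?mass_ge0.
have T2 : mass (lsubmx t) <= T by rewrite /T addrCA lerDl !addr_ge0// ?mass_ge0.
have T3 : mass (rsubmx t) <= T + Defs.total (lsubmx t).
  rewrite -lerBlDr.
  apply: (@le_trans _ _ (mass (rsubmx t) + `|Defs.total (lsubmx t)|)).
    by rewrite lerD2l -normrN ler_norm.
  by rewrite /T addrA lerDr addr_ge0// ?mass_ge0.
rewrite -(deformed_processE _ _ T1); last by rewrite addn_gt0 i0.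
rewrite -(deformed_processE _ _ T2)// -(deformed_shift _ _ T3)//.
rewrite -uconjM; last exact: cocycle_dunitary.
by rewrite (sp_cup hj).
Qed.

Lemma deformed_star i (x : G i) : (0 < i)%N ->
  j' (gr_star x) = cochain_star ip alpha' (j' x).
Proof.
move=> i0; apply/funext => t; rewrite /cochain_star.
set r := \row_(l < i) - _.
pose T := mass t + (mass r + `|Defs.total t|).
have T1 : mass t <= T by rewrite lerDl !addr_ge0// ?mass_ge0.
have T2 : mass r <= T + Defs.total t.
  rewrite -lerBlDr; apply: (@le_trans _ _ (mass r + `|Defs.total t|)).
    by rewrite lerD2l -normrN ler_norm.
  by rewrite /T lerDr mass_ge0.
rewrite -(deformed_processE _ _ T1)// -(deformed_shift _ _ T2)//.
rewrite uconj_adj; last exact: cocycle_dunitary.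
rewrite -uconjZ; last exact: cocycle_dunitary.
by rewrite (sp_star hj).
Qed.

(** The differential of the new cochain for the new group is the image under one
    [w_(-T)] of the differential of the old cochain for the old group, which
    vanishes. *)
Lemma deformed_differential i (x : G i) : (0 < i)%N ->
  differential ip alpha' (j' x) = (fun=> 0).
Proof.
move=> i0; apply/funext => t; rewrite /differential.
pose T := mass (col' ord0 t) + `|t 0 ord0| +
  (mass (col' ord_max t) + \sum_(k < i) mass (Defs.merge k t)).
have S0 : 0 <= \sum_(k < i) mass (Defs.merge k t).
  by apply: sumr_ge0 => k _; exact: mass_ge0.
have T1 : mass (col' ord0 t) <= T + t 0 ord0.
  rewrite -lerBlDr; apply: (@le_trans _ _ (mass (col' ord0 t) + `|t 0 ord0|)).
    by rewrite lerD2l -normrN ler_norm.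
  by rewrite /T lerDl addr_ge0// mass_ge0.
have T2 : mass (col' ord_max t) <= T.
  by rewrite /T addrCA lerDl !addr_ge0// mass_ge0.
have T3 k : mass (Defs.merge k t) <= T.
  rewrite /T (bigD1 k)//= addrA addrCA lerDl !addr_ge0// ?mass_ge0//.
  by apply: sumr_ge0 => l _; exact: mass_ge0.
rewrite -(deformed_shift _ _ T1)// -(deformed_processE _ _ T2)//.
have dW := cocycle_dunitary (- T).
have -> : \sum_(k < i) (-1) ^+ k.+1 *: j' x (Defs.merge k t) =
    \sum_(k < i) w (- T) ((-1) ^+ k.+1 *: j x (Defs.merge k t)).
  by apply: eq_bigr => k _; rewrite -(deformed_processE _ _ (T3 k))// uconjZ.
rewrite -uconj_sum// -uconjZ// -!uconjD//.
have [_ /(congr1 (@^~ t))] := sp_cocycle hj i0 x.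
by rewrite /differential => ->; rewrite uconj0.
Qed.

Definition deformed_algebra : set (D -> D) :=
  generated ip [set a | exists i (x : G i) t, (0 < i)%N /\ a = j' x t].

Local Notation M' := deformed_algebra.

Lemma deformed_values_adjointable :
  [set a | exists i (x : G i) t, (0 < i)%N /\ a = j' x t] `<=`
  [set x : D -> D | exists y, adjoint_pair dot x y].
Proof.
move=> _ [i [x [t [i0 ->]]]].
have [y xy] := opalg_adjointable (sp_algebra hj) (process_mem x t i0).
exists (w (- mass t) y); apply: uconj_adjoint_pair => //; exact: cocycle_dunitary.
Qed.

Lemma deformed_opalg : star_opalg ip M'.
Proof. exact: generated_opalg deformed_values_adjointable. Qed.

Lemma deformed_mem i (x : G i) t : (0 < i)%N -> M' (j' x t).
Proof. by move=> i0; apply: sub_generated; exists i, x, t. Qed.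

(** The cocycle identity of the new process at the times [(t, s)] expresses the
    action of the group on a generator of the algebra through other
    generators. *)
Lemma deformed_acts : acts_on ip alpha' M'.
Proof.
move=> t; have [i' s'] := deformed_implements t.
split; first by exists (W t \o implementer ip (alpha t)).
apply: (generated_uconj (deformed_dunitary t)
  deformed_values_adjointable deformed_opalg).
move=> _ [i [x [s [i0 ->]]]]; rewrite -/(A' t _).
pose r : 'rV[R]_i.+1 := row_mx (const_mx t : 'rV_1) s.
have r0 : r 0 ord0 = t.
  have e : lshift i (@ord0 0) = ord0 by exact: val_inj.
  by have := row_mxEl (const_mx t : 'rV_1) s 0 ord0; rewrite e [RHS]mxE.
have rs : col' ord0 r = s.
  apply/rowP => l; rewrite mxE.
  have e : rshift 1 l = lift ord0 l by exact: val_inj.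
  by have := row_mxEr (const_mx t : 'rV_1) s 0 l; rewrite e.
have := congr1 (@^~ r) (deformed_differential x i0).
rewrite /differential r0 rs -addrA => /eqP; rewrite addr_eq0 => /eqP ->.
have alg := deformed_opalg.
rewrite -scaleN1r; apply: (opalgZ alg); apply: (opalgD alg).
  by apply: (opalg_sum alg) => k; apply: (opalgZ alg); exact: deformed_mem.
by apply: (opalgZ alg); exact: deformed_mem.
Qed.

Lemma deformed_stationary : stationary_process ip alpha' M' j'.
Proof.
split.
- apply: (perturbed_automorphism_group ip_norm (sp_group hj)).
  + by move=> t; exists (implementer ip (alpha t)); case: (group_implementer t).
  + exact: (mc_unitary hW).
  + exact: (mc_continuous hW).
  + exact: (mc_cocycle hW).
- exact: deformed_opalg.
- exact: deformed_acts.
- by move=> i i0 c x y t; exact: deformed_linear.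
- move=> i i0 x; split; first by move=> t; exact: deformed_mem.
  exact: deformed_differential.
- by move=> i k i0 k0 x y; exact: deformed_cup.
- by move=> i i0 x; exact: deformed_star.
- by [].
Qed.

Lemma deformed_value1 k t :
  (0 <= t -> value1 j' k t = value1 j k t) /\
  (t <= 0 -> value1 j' k t = w t (value1 j k t)).
Proof.
rewrite /value1 /j' mass_const -/(value1 j k t); split => t0; last first.
  by rewrite ler0_norm// opprK.
rewrite ger0_norm//.
have t00 : 0 <= 0 + t by rewrite add0r.
have := value1_fix k t0 (lexx 0) t00.
by rewrite act0//; exact: value1_linear.
Qed.

End deformation.

(** Products determine the values in all degrees from those in degree 1, and the
    values generate the algebra. *)
Lemma stationary_process_unique (R : realType) (H : completeNormedModType R[i])
  (ip : {dot H for Num.conj}) (P : {pred H}) (D : subLmodType P)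
  (K : involutiveAlg R) (G : gradedAlg K) (alpha : R -> (H -> H) -> (H -> H))
  (M1 M2 : set (D -> D)) (j1 j2 : forall i, G i -> cochain D i) :
  stationary_process ip alpha M1 j1 -> stationary_process ip alpha M2 j2 ->
  (forall x t, value1 j1 x t = value1 j2 x t) ->
  M1 = M2 /\ forall i (x : G i), (0 < i)%N -> j1 i x = j2 i x.
Proof.
move=> h1 h2 v12.
have j12 i (x : G i) : (0 < i)%N -> j1 i x = j2 i x.
  move=> i0; move: i i0 x; apply: graded_ind.
  - by move=> k; apply/funext => t; rewrite (row1E t); exact: v12.
  - move=> n n0; apply/funext => t.
    have := sp_linear h1 n0 (-1) 0 0 t; have := sp_linear h2 n0 (-1) 0 0 t.
    by rewrite !scaler0 !addr0 !scaleN1r !addNr => -> ->.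
  - move=> n n0 x y hx hy; apply/funext => t.
    have := sp_linear h1 n0 1 x y t; have := sp_linear h2 n0 1 x y t.
    by rewrite !scale1r hx hy => -> ->.
  - by move=> n n0 x y hx hy; rewrite (sp_cup h1)// (sp_cup h2)// hx hy.
split => //; rewrite (sp_generated h1) (sp_generated h2); congr generated.
by apply/seteqP; split => _ [i [x [t [i0 ->]]]]; exists i, x, t; rewrite j12.
Qed.

Theorem theorem5p1 (R : realType) (H : completeNormedModType R[i])
  (ip : {dot H for Num.conj}) (ip_norm : forall u : H, `|u| ^+ 2 = ip u u)
  (P : {pred H}) (D : subLmodType P) (D_dense : dense (range (val : D -> H)))
  (K : involutiveAlg R) (G : gradedAlg K)
  (alpha : R -> (H -> H) -> (H -> H)) (M : set (D -> D))
  (j : forall i, G i -> cochain D i)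
  (hj : stationary_process ip alpha M j)
  (W : R -> (H -> H))
  (hW : multiplicative_cocycle ip D alpha W)
  (hM : markovian ip j W) :
  let alpha' := fun t a => bconj ip (W t) (alpha t a) in
  exists (M' : set (D -> D)) (j' : forall i, G i -> cochain D i),
    [/\ stationary_process ip alpha' M' j',
        forall x t,
          (0 <= t -> value1 j' x t = value1 j x t) /\
          (t <= 0 -> value1 j' x t = uconj ip (W t) (value1 j x t)),
        forall t x, M' x -> act ip (alpha' t) x = uconj ip (W t) (act ip (alpha t) x) &
        forall (M'' : set (D -> D)) (j'' : forall i, G i -> cochain D i),
          stationary_process ip alpha' M'' j'' ->
          (forall x t, value1 j'' x t = value1 j' x t) ->
          M'' = M' /\ forall i (x : G i), (0 < i)%N -> j'' i x = j' i x].
Proof.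
move=> alpha'.
have st := deformed_stationary ip_norm hj hW hM.
exists (deformed_algebra ip j W), (deformed_process ip j W); split => //.
- by move=> x t; exact: (deformed_value1 ip_norm hj hW hM).
- move=> t x /(opalg_linear (sp_algebra st)); exact: (deformed_act ip_norm hj hW).
- by move=> M'' j'' st'' v; exact: stationary_process_unique st'' st v.
Qed.
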